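(* Let $\delta\in(0,1)$ and $\iota=2\log(4(m+1)F/\delta)$. Suppose there is a Nash equilibrium $\pi^*$ satisfying the one-unit deviation assumption with respect to $\rho$, and let $C_{\mathrm{facility}}$ be the facility unilateral coefficient of $\pi^*$. Let $\pi^{\mathrm{out}}$ be the output of the surrogate-minimization procedure run with the facility-level estimator $\hat r$ and bonus $b$ defined in the context. Then, with probability at least $1-\delta$, $$\mathrm{Gap}(\pi^{\mathrm{out}})\le \frac{8\sqrt{m+1}\,C_{\mathrm{facility}}\,\iota\, F}{\sqrt n}.$$
   Context: Congestion game setting. There are $m\ge 1$ players and a finite facility set $\mathcal F$ with $F=|\mathcal F|$. Each player $i\in[m]$ has a nonempty finite action set $\mathcal A_i\subseteq 2^{\mathcal F}$; $\mathcal A=\prod_i\mathcal A_i$. For $f\in\mathcal F$ let $n^f(\bm a)=|\{i: f\in a_i\}|$. For each $f$ and $\ell\in\{1,\dots,m\}$ there is a reward distribution $R^f(\cdot\mid \ell)$ supported in $[-1,1]$ with mean $r^f(\ell)$; player $i$'s mean reward is $r_i(\bm a)=\sum_{f\in a_i} r^f(n^f(\bm a))$. A product policy is $\pi=\otimes_i\pi_i$ with $\pi_i\in\Delta(\mathcal A_i)$; $(\pi_i',\pi_{-i})$ replaces the $i$-th component. $V_i^\pi=\mathbb E_{\bm a\sim\pi}[r_i(\bm a)]$, $\mathrm{Gap}(\pi)=\max_i\big[\max_{\pi_i'}V_i^{(\pi_i',\pi_{-i})}-V_i^{\pi}\big]$, and a Nash equilibrium is a product policy with $\mathrm{Gap}=0$.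 Facility-level offline data: $\mathcal D=\{(\bm a^k,\bm r^k)\}_{k=1}^n$ where $\bm a^1,\dots,\bm a^n$ are i.i.d. from $\rho\in\Delta(\mathcal A)$, and, given the joint actions, for each $k$ and each facility $f$ with $n^f(\bm a^k)\ge1$ a reward $r^{f,k}\sim R^f(\cdot\mid n^f(\bm a^k))$ is drawn, all draws independent; $\bm r^k=\{r^{f,k}\}_{f:\,n^f(\bm a^k)\ge1}$. Estimator and bonus: for $f\in\mathcal F$ and $\ell\in\{0,\dots,m\}$ let $N^f(\ell)=|\{k: n^f(\bm a^k)=\ell\}|$. Define $\hat r_i(\bm a)=\sum_{f\in a_i}\frac{\sum_{k=1}^n r^{f,k}\,\mathbb 1\{n^f(\bm a^k)=n^f(\bm a)\}}{N^f(n^f(\bm a))\vee 1}$ and $b_i(\bm a)=\sum_{f\in a_i}\sqrt{\frac{\iota}{N^f(n^f(\bm a))\vee1}}$. Surrogate minimization: $\overline V_i^{\pi}=\mathbb E_{\bm a\sim\pi}[\hat r_i+b_i]$, $\underline V_i^{\pi}=\mathbb E_{\bm a\sim\pi}[\hat r_i-b_i]$, $\overline V_i^{\dagger,\pi_{-i}}=\max_{\pi_i'}\overline V_i^{(\pi_i',\pi_{-i})}$, and $\pi^{\mathrm{out}}\in\arg\min_{\pi\text{ product}}\max_i[\overline V_i^{\dagger,\pi_{-i}}-\underline V_i^{\pi}]$. Facility cumulative density: for a distribution $\pi$ on $\mathcal A$, $d^\pi_f(\ell)=\sum_{\bm a:\,n^f(\bm a)=\ell}\pi(\bm a)$. One-unit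 deviation assumption: for every $i\in[m]$, every $\pi_i\in\Delta(\mathcal A_i)$, every $f\in\mathcal F$ and $\ell\in\{0,\dots,m\}$, if $d^{(\pi_i,\pi^*_{-i})}_f(\ell)>0$ then $d^\rho_f(\ell)>0$. Facility unilateral coefficient: $C_{\mathrm{facility}}=\max\big\{ d^{(\pi_i',\pi^*_{-i})}_f(\ell)/d^\rho_f(\ell):\ i\in[m],\ \pi_i'\in\Delta(\mathcal A_i),\ f\in\mathcal F,\ \ell\in\{0,\dots,m\},\ d^\rho_f(\ell)>0\big\}$. *)

(* Defs.v *)
From HB Require Import structures.
From mathcomp Require Import all_boot all_order all_algebra.
From mathcomp Require Import all_classical all_reals all_analysis.
Set Implicit Arguments. Unset Strict Implicit. Unset Printing Implicit Defensive.
Import Order.TTheory GRing.Theory Num.Theory.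
Local Open Scope ring_scope.

Section CongestionGame.
Variables (R : realType) (m : nat) (Fac : finType).

Definition jact := {ffun 'I_m -> {set Fac}}.

Definition nf (f : Fac) (a : jact) : nat := #|[set i : 'I_m | f \in a i]|.

Definition reward (rf : Fac -> nat -> R) (i : 'I_m) (a : jact) : R :=
  \sum_(f in a i) rf f (nf f a).

Definition is_policy (Ai : {set {set Fac}}) (p : {set Fac} -> R) : Prop :=
  (forall s, 0 <= p s) /\ (\sum_(s : {set Fac}) p s = 1) /\
  (forall s, s \notin Ai -> p s = 0).

Definition policy := 'I_m -> {set Fac} -> R.

Definition is_prod_policy (A : 'I_m -> {set {set Fac}}) (pi : policy) : Prop :=
  forall i, is_policy (A i) (pi i).

Definition prodp (pi : policy) (a : jact) : R := \prod_(i < m) pi i (a i).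

Definition dev (pi : policy) (i : 'I_m) (p : {set Fac} -> R) : policy :=
  fun j => if j == i then p else pi j.

Definition value (r : 'I_m -> jact -> R) (i : 'I_m) (pi : policy) : R :=
  \sum_(a : jact) prodp pi a * r i a.

Definition Gap (A : 'I_m -> {set {set Fac}}) (rf : Fac -> nat -> R) (pi : policy) : R :=
  sup [set x | exists i : 'I_m,
        x = sup [set y | exists p, is_policy (A i) p /\
                   y = value (reward rf) i (dev pi i p)]
            - value (reward rf) i pi].

Definition is_Nash (A : 'I_m -> {set {set Fac}}) (rf : Fac -> nat -> R) (pi : policy) : Prop :=
  is_prod_policy A pi /\ Gap A rf pi = 0.

Definition dens (p : jact -> R) (f : Fac) (l : nat) : R :=
  \sum_(a : jact | nf f a == l) p a.

Definition one_unit_deviation (A : 'I_m -> {set {set Fac}}) (pistar : policy)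
    (rho : jact -> R) : Prop :=
  forall (i : 'I_m) (p : {set Fac} -> R) (f : Fac) (l : nat),
    is_policy (A i) p -> (l <= m)%N ->
    0 < dens (prodp (dev pistar i p)) f l -> 0 < dens rho f l.

(* facility unilateral coefficient (a max, written as the sup of the set) *)
Definition C_facility (A : 'I_m -> {set {set Fac}}) (pistar : policy)
    (rho : jact -> R) : R :=
  sup [set x | exists (i : 'I_m) (p : {set Fac} -> R) (f : Fac) (l : nat),
         [/\ is_policy (A i) p, (l <= m)%N, 0 < dens rho f l &
             x = dens (prodp (dev pistar i p)) f l / dens rho f l]].

Variable n : nat.
(* dataset: joint actions aseq k and rewards rseq k f (only used when n^f(a^k)>=1) *)

Definition Ncount (aseq : 'I_n -> jact) (f : Fac) (l : nat) : nat :=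
  #|[set k : 'I_n | nf f (aseq k) == l]|.

Definition rhat (aseq : 'I_n -> jact) (rseq : 'I_n -> Fac -> R)
    (i : 'I_m) (a : jact) : R :=
  \sum_(f in a i)
     (\sum_(k < n) rseq k f * (nf f (aseq k) == nf f a)%:R)
       / (maxn (Ncount aseq f (nf f a)) 1)%:R.

Definition bonus (iota : R) (aseq : 'I_n -> jact) (i : 'I_m) (a : jact) : R :=
  \sum_(f in a i) Num.sqrt (iota / (maxn (Ncount aseq f (nf f a)) 1)%:R).

Definition Vup (iota : R) aseq rseq (i : 'I_m) (pi : policy) : R :=
  value (fun i a => rhat aseq rseq i a + bonus iota aseq i a) i pi.

Definition Vlo (iota : R) aseq rseq (i : 'I_m) (pi : policy) : R :=
  value (fun i a => rhat aseq rseq i a - bonus iota aseq i a) i pi.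

Definition Vdag (A : 'I_m -> {set {set Fac}}) (iota : R) aseq rseq
    (i : 'I_m) (pi : policy) : R :=
  sup [set y | exists p, is_policy (A i) p /\ y = Vup iota aseq rseq i (dev pi i p)].

Definition surrogate (A : 'I_m -> {set {set Fac}}) (iota : R) aseq rseq
    (pi : policy) : R :=
  sup [set x | exists i : 'I_m,
         x = Vdag A iota aseq rseq i pi - Vlo iota aseq rseq i pi].

Definition is_surrogate_min (A : 'I_m -> {set {set Fac}}) (iota : R) aseq rseq
    (pi : policy) : Prop :=
  is_prod_policy A pi /\
  forall pi', is_prod_policy A pi' ->
    surrogate A iota aseq rseq pi <= surrogate A iota aseq rseq pi'.

End CongestionGame.

Definition mean_reward (R : realType) (Fac : finType)
    (Rd : Fac -> nat -> probability R R) (f : Fac) (l : nat) : R :=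
  fine (\int[Rd f l]_x (x%:E))%E.

(* Main.v *)
Require Import Defs.
From HB Require Import structures.
From mathcomp Require Import all_boot all_order all_algebra.
From mathcomp Require Import all_classical all_reals all_analysis.
From mathcomp Require Import ring lra.
Set Implicit Arguments. Unset Strict Implicit. Unset Printing Implicit Defensive.
Import Order.TTheory GRing.Theory Num.Theory.
Local Open Scope ring_scope.

(** Optimism reduces the gap of the output to the surrogate objective at the Nash
    equilibrium, which is at most four times the expected bonus of a unilateral
    deviation from it.  Weighting by the facility densities, this bonus is
    controlled by [sum_(f, l) d(f, l) sqrt (iota / N(f, l))], where a lower
    Chernoff bound gives [N(f, l) >= n rho(f, l) / (4 iota)], coverage gives
    [d <= C rho], and Cauchy-Schwarz over the [m + 1] congestion levels gives the
    factor [sqrt (m + 1)].  Optimism itself is Hoeffding's inequality for each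
    pair (f, l), conditionally on the joint actions.

    The law of the data is only given on boxes, so Hoeffding's inequality is
    proved by rounding the rewards to a finite grid on [-1, 1] and expanding the
    exponential moment as a finite sum over boxes.  The rounding costs a factor
    [exp kappa]; with [exp kappa = 3 / 2] the failure probabilities still fit:
    [3 exp (- L)] for Hoeffding and [exp (- L)] for Chernoff, at each of the
    [(m + 1) F] pairs, where [exp (- L) = delta / (4 (m + 1) F)]. *)

(** * Hoeffding's inequality from box probabilities *)

Lemma derive_le0_le (R : realType) (f df : R -> R) :
  (forall x : R, is_derive x 1 f (df x)) -> (forall x : R, 0 <= x -> df x <= 0) ->
  forall x, 0 <= x -> f x <= f 0.
Proof.
move=> fdf df_le0 x x_ge0; apply: (ler0_derive1_nincry (a := 0)) => //.
- move=> y; rewrite in_itv/= andbT => /ltW y0.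
  by have fdfy := fdf y; rewrite derive1E derive_val df_le0.
- by apply: derivable_within_continuous => y _; have fdfy := fdf y.
Qed.

(** Convexity of [expR]: [x] is the mean of [1] and [-1] with weights [(1 + x) / 2] and
    [(1 - x) / 2]. *)
Lemma expR_chord (R : realType) (l x : R) : -1 <= x <= 1 ->
  expR (l * x) <= (1 + x) / 2 * expR l + (1 - x) / 2 * expR (- l).
Proof.
move=> /andP[x1 x2].
have t01 : 0 <= (1 + x) / 2 <= 1 by lra.
have := convex_expR (Itv01 (proj1 (andP t01)) (proj2 (andP t01))) l (- l).
have -> : (1 - x) / 2 = 1 - (1 + x) / 2 by field.
rewrite !convRE/= /unstable.onem.
by have <- : l * x = (1 + x) / 2 * l + (1 - (1 + x) / 2) * - l by field.
Qed.

(** Since [h] is its own second derivative, [h' / h] has derivative [1 - (h' / h) ^+ 2 <= 1], hence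
    [h' / h <= r + x]; integrating once more bounds the logarithm of [h]. *)
Lemma derive2_fixed_le (R : realType) (h h' : R -> R) (r l : R) :
  (forall x : R, 0 < h x) ->
  (forall x : R, is_derive x 1 h (h' x)) ->
  (forall x : R, is_derive x 1 h' (h x)) ->
  h 0 = 1 -> h' 0 = r -> 0 <= l -> h l <= expR (l * r + l ^+ 2 / 2).
Proof.
move=> h_gt0 dh dh' h0 h'0 l0.
have h'_le x : 0 <= x -> h' x <= (r + x) * h x.
  move=> x0; rewrite -ler_pdivrMr// -subr_le0.
  pose g y := h' y * (h y)^-1 - (r + y).
  have g0 : g 0 = 0 by rewrite /g h0 h'0; field.
  have : g x <= g 0; last by rewrite g0.
  apply: (@derive_le0_le _ g (fun y => - (h' y / h y) ^+ 2)) x0 => y.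
    have hy : h y != 0 by rewrite gt_eqF.
    have dV : is_derive y 1 (fun y => (h y)^-1) (- (h y) ^- 2 *: h' y).
      exact: is_deriveV.
    have dM := is_deriveM (dh' y) dV.
    have dA := is_deriveD (is_derive_cst r y 1) (is_derive_id y 1).
    apply: (is_derive_eq (is_deriveB dM dA)).
    by rewrite /GRing.scale/=; field.
  by move=> _; rewrite oppr_le0 sqr_ge0.
pose q x := h x * expR (- (x * r + x ^+ 2 / 2)).
have : q l <= q 0.
  apply: (@derive_le0_le _ q
    (fun x => (h' x - (r + x) * h x) * expR (- (x * r + x ^+ 2 / 2)))) l0 => y.
    apply: is_derive_eq; rewrite /GRing.scale/=.
    by field.
  by move=> y0; rewrite mulr_le0_ge0 ?expR_ge0// subr_le0 h'_le.
rewrite {2}/q mul0r expr0n/= mul0r addr0 oppr0 expR0 mulr1 h0.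
by rewrite /q expRN ler_pdivrMr ?expR_gt0// mul1r.
Qed.

(** As a function of [l], the left side is the moment generating function of the law on [1] and [-1]
    with mean [r], and it equals its own second derivative. *)
Lemma hoeffding_two_point (R : realType) (r l : R) : -1 <= r <= 1 -> 0 <= l ->
  (1 + r) / 2 * expR l + (1 - r) / 2 * expR (- l) <= expR (l * r + l ^+ 2 / 2).
Proof.
move=> /andP[r1 r2].
apply: (@derive2_fixed_le _
  (fun x => (1 + r) / 2 * expR x + (1 - r) / 2 * expR (- x))
  (fun x => (1 + r) / 2 * expR x - (1 - r) / 2 * expR (- x))) => [x|x|x||].
- have := expR_gt0 x; have := expR_gt0 (- x) => a b.
  have [r0|r0] := leP 0 r.
    by apply: ltr_pwDl; [apply: mulr_gt0|apply: mulr_ge0]; lra.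
  by apply: ltr_wpDl; [apply: mulr_ge0|apply: mulr_gt0]; lra.
- by apply: is_derive_eq; rewrite /GRing.scale/=; ring.
- by apply: is_derive_eq; rewrite /GRing.scale/=; ring.
- by rewrite oppr0 expR0; field.
- by rewrite oppr0 expR0; field.
Qed.

(** The chord bound replaces the law of [x] by the two-point law on [1] and [-1] with the same
    mean. *)
Lemma hoeffding_discrete (R : realType) (J : finType) (q x : J -> R) (t : R) :
  (forall j, 0 <= q j) -> \sum_j q j = 1 -> (forall j, -1 <= x j <= 1) ->
  0 <= t ->
  \sum_j q j * expR (t * x j) <= expR (t * (\sum_j q j * x j) + t ^+ 2 / 2).
Proof.
move=> q0 q1 x1 t0; set r := \sum_j q j * x j.
apply: le_trans (hoeffding_two_point _ t0); last first.
  have [lb ub] : -1 <= r /\ r <= 1; last by rewrite lb ub.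
  split.
    rewrite (_ : -1 = \sum_j q j * -1); last by rewrite -mulr_suml q1 mul1r.
    by apply: ler_sum => j _; rewrite ler_wpM2l//; case/andP: (x1 j).
  rewrite -[leRHS]q1; apply: ler_sum => j _.
  by rewrite -[leRHS]mulr1 ler_wpM2l//; case/andP: (x1 j).
have -> : (1 + r) / 2 * expR t + (1 - r) / 2 * expR (- t) =
    \sum_j q j * ((1 + x j) / 2 * expR t + (1 - x j) / 2 * expR (- t)).
  have qE j : q j * ((1 + x j) / 2 * expR t + (1 - x j) / 2 * expR (- t)) =
      q j * ((expR t + expR (- t)) / 2) + q j * x j * ((expR t - expR (- t)) / 2).
    by field.
  rewrite (eq_bigr _ (fun j _ => qE j)) big_split/= -!mulr_suml q1 -/r.
  by field.
by apply: ler_sum => j _; rewrite ler_wpM2l// expR_chord.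
Qed.

(** * Statements outside a small exceptional event *)

(** The measurable set [B] carries the probability bound, so [Q] itself need not be measurable. *)
Definition holds_off d (T : measurableType d) (R : realType)
    (P : probability T R) (p : R) (Q : T -> Prop) : Prop :=
  exists B : set T, [/\ measurable B, (P B <= p%:E)%E & forall w, ~ B w -> Q w].

Section holds_off.
Context d (T : measurableType d) (R : realType) (P : probability T R).
Implicit Types (p q : R) (Q : T -> Prop).

Lemma holds_offW p q Q Q' : holds_off P p Q -> p <= q ->
  (forall w, Q w -> Q' w) -> holds_off P q Q'.
Proof.
move=> [B [mB PB BQ]] pq QQ'; exists B; split => [//||w /BQ/QQ'//].
by rewrite (le_trans PB)// lee_fin.
Qed.

Lemma holds_off_and p q Q Q' : holds_off P p Q -> holds_off P q Q' ->
  holds_off P (p + q) (fun w => Q w /\ Q' w).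
Proof.
move=> [B [mB PB BQ]] [C [mC PC CQ]]; exists (B `|` C)%classic; split.
- exact: measurableU.
- by rewrite EFinD; apply: le_trans (measureU2 _ mB mC) (leeD PB PC).
- by move=> w /not_orP[/BQ ? /CQ].
Qed.

Lemma holds_off_forall (I : finType) (p : I -> R) (Q : I -> T -> Prop) :
  (forall i, holds_off P (p i) (Q i)) ->
  holds_off P (\sum_i p i) (fun w => forall i, Q i w).
Proof.
move=> offQ.
suff : holds_off P (\sum_(i <- index_enum I) p i)
    (fun w => forall i, i \in index_enum I -> Q i w).
  by move=> /holds_offW; apply=> // w Qw i; apply: Qw; rewrite mem_index_enum.
elim: (index_enum I) => [|i s IH].
  by exists set0; split => //; rewrite measure0 big_nil.
rewrite big_cons; apply: holds_offW (holds_off_and (offQ i) IH) (lexx _) _.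
by move=> w [Qi Qs] j; rewrite inE => /predU1P[->//|/Qs].
Qed.

End holds_off.

(** * Rounding bounded rewards to a finite grid *)

Lemma discretization (R : realType) (eps : R) : 0 < eps ->
  exists M (c : R -> 'I_M.+1) (x : 'I_M.+1 -> R),
  [/\ forall j, measurable [set y | c y = j]%classic,
      forall j, -1 <= x j <= 1 &
      forall y, -1 <= y <= 1 -> `|y - x (c y)| <= eps].
Proof.
move=> eps0; pose M := (Num.truncn (2 / eps)).+1; pose h : R := 2 / M%:R.
have M0 : 0 < M%:R :> R by rewrite ltr0n.
have h0 : 0 < h by rewrite divr_gt0.
have heps : h <= eps.
  by rewrite ler_pdivrMr// mulrC -ler_pdivrMr// ltW// truncnS_gt.
have hM : h * M%:R = 2 by rewrite /h divfK// gt_eqF.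
exists M, (fun y => inord (Num.truncn ((y + 1) / h))), (fun j => -1 + j%:R * h).
split.
- move=> j.
  have mle i : measurable [set y : R | (Num.truncn ((y + 1) / h) < i)%N]%classic.
    case: i => [|i]; first by rewrite (_ : [set y | _]%classic = set0)// -subset0.
    rewrite (_ : [set y | _]%classic = `]-oo, (i.+1%:R * h - 1)[%classic)//.
    apply/seteqP; split => y /=; rewrite in_itv/= ltnS truncn_le_nat;
      by rewrite ltr_pdivrMr// ltrBrDr.
  (* [inord] sends every index above [M] to [0], so a cell may collect infinitely many values of the
     truncation. *)
  rewrite (_ : [set y | _]%classic = \bigcup_(i in [set i | inord i = j])
      ([set y : R | (Num.truncn ((y + 1) / h) < i.+1)%N] `\`
       [set y : R | (Num.truncn ((y + 1) / h) < i)%N]))%classic; last first.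
    apply/seteqP; split => [y yj|y [i /= ij [yi /negP]]].
      by exists (Num.truncn ((y + 1) / h)) => //=; split; rewrite /= ?ltnS// ltnn.
    rewrite -leqNgt => iy; rewrite -ij; congr inord.
    by apply/eqP; rewrite eqn_leq iy -ltnS yi.
  by apply: bigcup_measurable => i _; apply: measurableD.
- move=> j; have : j%:R * h <= 2 by rewrite -hM mulrC ler_pM2l// ler_nat -ltnS.
  have : 0 <= j%:R * h by rewrite mulr_ge0 ?ler0n ?ltW.
  by lra.
- move=> y /andP[y1 y2]; set z := (y + 1) / h.
  have yz : y = -1 + z * h by rewrite /z divfK ?gt_eqF//; ring.
  have z0 : 0 <= z by rewrite divr_ge0 ?(ltW h0)//; lra.
  have zM : z <= M%:R by rewrite ler_pdivrMr// mulrC hM; lra.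
  rewrite inordK ?ltnS; last by rewrite truncn_le_nat (le_lt_trans zM)// ltr_nat.
  have /andP[tz zt] := truncn_itv z0.
  rewrite {1}yz (_ : _ - _ = (z - (Num.truncn z)%:R) * h); last by ring.
  rewrite normrM (gtr0_norm h0) ger0_norm ?subr_ge0//.
  rewrite (le_trans _ heps)// ler_piMl ?(ltW h0)//.
  by move: zt; rewrite -natr1; lra.
Qed.

Section bounded_law.
Context (R : realType) (mu : probability R R).
Hypothesis mu1 : mu `[(-1 : R), 1]%classic = 1%E.

Let itvC0 : mu (~` `[(-1 : R), 1])%classic = 0%E.
Proof. by rewrite probability_setC// mu1 subee. Qed.

Lemma measure_setI_bounded (C : set R) : measurable C ->
  mu (`[(-1 : R), 1] `&` C)%classic = mu C.
Proof.
move=> mC; rewrite setIC (measureDI mu mC (measurable_itv `[(-1 : R), 1])).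
rewrite [X in _ = (X + _)%E](_ : _ = 0%E) ?add0e//.
apply/eqP; rewrite -measure_le0 -itvC0; apply: le_measure; rewrite ?inE.
- exact: measurableD.
- exact: measurableC.
- by move=> y [].
Qed.

Lemma integral_id_itv : (\int[mu]_y y%:E = \int[mu]_(y in `[(-1)%R, 1%R]) y%:E)%E.
Proof.
rewrite -(setUv `[(-1 : R), 1]%classic) integral_setU//.
- rewrite [X in (_ + X)%E]null_set_integral ?adde0//.
  exact: measurableC.
- exact: measurableC.
- by apply/disj_setPCl.
Qed.

Lemma integral_id_bounds (D : set R) (a b : R) : measurable D ->
  (D `<=` `[(-1 : R), 1])%classic -> (forall y, D y -> a <= y <= b) ->
  ((a * fine (mu D))%:E <= \int[mu]_(y in D) y%:E <= (b * fine (mu D))%:E)%E.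
Proof.
move=> mD D1 Dab.
have muD : mu D = (fine (mu D))%:E by rewrite fineK// fin_num_measure.
have iD (f : R -> R) : measurable_fun D f -> [bounded f y | y in D]%classic ->
    mu.-integrable D (EFin \o f).
  move=> mf bf; apply: measurable_bounded_integrable => //.
  by rewrite -ge0_fin_numE// fin_num_measure.
have bD r : mu.-integrable D (cst r%:E).
  by apply: (iD (cst r)) => //; exists `|r|; split => // M rM y _ /=; rewrite ltW.
have idD : mu.-integrable D (EFin \o id).
  apply: iD => //; exists 1; split => // M M1 y /D1/=.
  by rewrite in_itv/= -ler_norml => /le_trans; apply; rewrite ltW.
rewrite !EFinM -muD -!(integral_cst mu mD).
by apply/andP; split; apply: le_integral => // y; rewrite inE => /Dab/andP[];
  rewrite lee_fin.
Qed.


Lemma mean_bounds : -1 <= fine (\int[mu]_y y%:E)%E <= 1.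
Proof.
have /andP[] := @integral_id_bounds `[(-1 : R), 1]%classic (-1) 1
  (measurable_itv _) (@subset_refl _ _) (fun y => id).
rewrite integral_id_itv mu1/= !mulr1; case: (integral _ _ _) => [r| |]//.
by rewrite !lee_fin => -> ->.
Qed.

Lemma sum_cells n (c : R -> 'I_n) :
  (forall j, measurable [set y | c y = j]%classic) ->
  \sum_j fine (mu [set y | c y = j]%classic) = 1.
Proof.
move=> mC; apply: EFin_inj; rewrite -sumEFin.
under eq_bigr do rewrite fineK ?fin_num_measure//.
rewrite -measure_bigsetU_ord//.
  rewrite -bigcup_seq (_ : \bigcup_(_ in _) _ = setT)%classic.
    exact: probability_setT.
  by apply/seteqP; split => // y _; exists (c y) => //=; rewrite mem_index_enum.
by apply/trivIsetP => i j _ _ ij; rewrite -subset0 => y [/= -> /eqP]; apply/negP.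
Qed.

(** On the part of cell [j] inside [[-1, 1]], which carries all its mass, [y] is within [eps] of
    [x j]; integrating cell by cell gives both bounds. *)
Lemma discretization_mean n (c : R -> 'I_n) (x : 'I_n -> R) (eps : R) :
  (forall j, measurable [set y | c y = j]%classic) ->
  (forall y, -1 <= y <= 1 -> `|y - x (c y)| <= eps) ->
  `|\sum_j fine (mu [set y | c y = j]%classic) * x j - fine (\int[mu]_y y%:E)%E|
    <= eps.
Proof.
move=> mC xc; set q := fun j => fine (mu [set y | c y = j]%classic).
pose D j := (`[(-1 : R), 1] `&` [set y | c y = j])%classic.
have mD j : measurable (D j) by exact: measurableI.
have intE : (\int[mu]_y y%:E = \sum_j \int[mu]_(y in D j) y%:E)%E.
  rewrite integral_id_itv -integral_bigsetU_EFin//.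
  - rewrite -bigcup_seq; congr (integral _ _ _).
    apply/seteqP; split => [y y1|y [j _ []]//].
    by exists (c y) => //=; rewrite mem_index_enum.
  - exact: index_enum_uniq.
  - apply/trivIsetP => i j _ _ ij; rewrite -subset0 => y [[_ /= yi] [_ /= yj]].
    by move: ij; rewrite -yi -yj eqxx.
  - exact/measurable_realfun.measurable_EFinP.
have cell_bounds j : (((x j - eps) * q j)%:E <= \int[mu]_(y in D j) y%:E <=
    ((x j + eps) * q j)%:E)%E.
  rewrite /q -measure_setI_bounded//.
  apply: integral_id_bounds; [exact: mD|by move=> y []|move=> y [/= y1 <-]].
  by move: y1; rewrite in_itv/= => /xc; rewrite ler_norml; lra.
have lb : ((\sum_j (x j - eps) * q j)%:E <= \int[mu]_y y%:E)%E.
  by rewrite intE -sumEFin; apply: lee_sum => j _; case/andP: (cell_bounds j).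
have ub : (\int[mu]_y y%:E <= (\sum_j (x j + eps) * q j)%:E)%E.
  by rewrite intE -sumEFin; apply: lee_sum => j _; case/andP: (cell_bounds j).
have sumq e : \sum_j (x j + e) * q j = \sum_j q j * x j + e.
  rewrite -[e in RHS]mulr1 -(sum_cells mC) mulr_sumr -big_split/=.
  by apply: eq_bigr => j _; rewrite /q; ring.
move: lb ub; rewrite !sumq; case: (integral _ _ _) => [r| |]//.
by rewrite !lee_fin ler_norml/=; lra.
Qed.

End bounded_law.

(** * Exponential moments and tail bounds *)

(** The sign [s] selects the tail. The rounding error [e] enters twice, as explicit slack and when
    [r] replaces the rounded mean, whence [2 * t * e]. *)
Lemma hoeffding_step (R : realType) (J : finType) (q x : J -> R) (s r t e : R) :
  (s = 1 \/ s = -1) -> (forall j, 0 <= q j) -> \sum_j q j = 1 ->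
  (forall j, -1 <= x j <= 1) -> 0 <= t ->
  `|\sum_j q j * x j - r| <= e ->
  \sum_j q j * expR (t * (s * x j + e - s * r - t)) <= expR (2 * t * e - t ^+ 2 / 2).
Proof.
move=> s1 q0 q1 x1 t0 re.
under eq_bigr => j _.
  rewrite (_ : t * _ = t * (s * x j) + t * (e - s * r - t)); last by ring.
  rewrite expRD mulrA; over.
rewrite -mulr_suml.
have sx1 j : -1 <= s * x j <= 1 by have := x1 j; case: s1 => ->; lra.
apply: le_trans (ler_wpM2r (expR_ge0 _) (hoeffding_discrete q0 q1 sx1 t0)) _.
rewrite -expRD ler_expR.
have -> : \sum_j q j * (s * x j) = s * \sum_j q j * x j.
  by rewrite mulr_sumr; apply: eq_bigr => j _; ring.
have : t * (s * (\sum_j q j * x j - r)) <= t * e.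
  by rewrite ler_wpM2l//; move: re; rewrite ler_norml; case: s1 => ->; lra.
lra.
Qed.

(* [A] is the event that fixes all joint actions and [p] its probability: given
   [A], the [X k] with [k \in S] are i.i.d. of law [mu]. *)
Section hoeffding.
Context d (T : measurableType d) (R : realType) (P : probability T R).
Context (I : finType) (S : {set I}) (A : set T) (X : I -> T -> R).
Context (mu : probability R R) (p : R).
Hypotheses (mA : measurable A) (mX : forall k, measurable_fun setT (X k)).
Hypotheses (mu1 : mu `[(-1 : R), 1]%classic = 1%E) (p0 : 0 <= p).
Hypothesis PAX : forall B : I -> set R, (forall k, measurable (B k)) ->
  P (A `&` [set w | forall k, k \in S -> B k (X k w)])%classic =
    (p * \prod_(k in S) fine (mu (B k)))%:E.

Let mean : R := fine (\int[mu]_y y%:E)%E.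

Let measurable_box (B : I -> set R) : (forall k, measurable (B k)) ->
  measurable (A `&` [set w | forall k, k \in S -> B k (X k w)])%classic.
Proof.
move=> mB; apply: measurableI => //.
rewrite (_ : [set w | _]%classic =
    \bigcap_(k in [set` S]) (X k @^-1` B k))%classic; last first.
  by apply/seteqP; split=> w /= BX k; apply: BX.
apply: fin_bigcap_measurable; first exact: finite_finpred.
move=> k _.
by have := mX k measurableT (mB k); rewrite setTI.
Qed.

(** Rounding is accurate only on [[-1, 1]]. The box forcing just coordinate [k] out of it has a zero
    factor in [PAX]. *)
Let bounded_off :
  holds_off P 0 (fun w => forall k, A w -> k \in S -> -1 <= X k w <= 1).
Proof.
have <- : \sum_(k : I) (0 : R) = 0 by rewrite big1.
apply: holds_off_forall => k; have [kS|kS] := boolP (k \in S); last first.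
  by exists set0; split; rewrite ?measure0//.
pose B k' : set R := if k' == k then (~` `[(-1 : R), 1])%classic else setT.
have mB k' : measurable (B k').
  by rewrite /B; case: ifP => // _; apply: measurableC.
exists (A `&` [set w | forall k, k \in S -> B k (X k w)])%classic; split.
- exact: measurable_box.
- rewrite PAX// (bigD1 k)//= /B eqxx probability_setC// mu1 subee//=.
  by rewrite mul0r mulr0.
- move=> w Bw Aw _; apply: contrapT => /negP X1; apply: Bw; split => //= k' k'S.
  by rewrite /B; case: eqP => // -> /=; rewrite in_itv/=; apply/negP.
Qed.

(** Markov's inequality over the finitely many cells of rounded rewards: a cell allowing a deviation
    above [t] has exponential weight at least [1], and the weighted sum over all cells factors over
    [k]. *)
Lemma hoeffding_one_sided (s t kappa : R) : s = 1 \/ s = -1 -> 0 <= t -> 0 < kappa ->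
  holds_off P (p * expR (kappa - #|S|%:R * (t ^+ 2 / 2)))
    (fun w => A w -> \sum_(k in S) s * (X k w - mean) <= #|S|%:R * t).
Proof.
move=> s1 t0 kappa0.
have den0 : 0 < 2 * #|S|%:R * t + 1.
  by rewrite ltr_wpDl// mulr_ge0// mulr_ge0.
(* Keeps the total rounding cost below [kappa]; the [+ 1] avoids a zero denominator when [S] is
   empty or [t] is [0]. *)
pose eps := kappa / (2 * #|S|%:R * t + 1).
have eps0 : 0 < eps by rewrite divr_gt0.
have epsk : #|S|%:R * (2 * t * eps) <= kappa.
  have -> : #|S|%:R * (2 * t * eps) = kappa - eps.
    by rewrite /eps; field; rewrite gt_eqF.
  by rewrite gerBl ltW.
have [M [c [x [mC x1 xc]]]] := discretization eps0.
pose q j := fine (mu [set y | c y = j]%classic).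
have q0 j : 0 <= q j by rewrite /q fine_ge0.
pose e j := t * (s * x j + eps - s * mean - t).
(* Coordinates outside [S] are pinned to [ord0] with weight [1], so each contributes a factor [1] to
   the sum over [J]. *)
pose Q (k : I) := [pred j : 'I_M.+1 | (k \in S) || (j == ord0)].
pose F (k : I) j := if k \in S then q j * expR (e j) else 1.
(* Marks the cells to be excluded: their rounded deviation, enlarged by [eps], exceeds the
   threshold. *)
pose good (J : {ffun I -> 'I_M.+1}) :=
  0 < \sum_(k in S) (s * x (J k) + eps - s * mean - t).
have cell_off J : holds_off P (if J \in family Q then p * \prod_k F k (J k) else 0)
    (fun w => A w -> J \in family Q -> good J ->
       ~ forall k, k \in S -> c (X k w) = J k).
  have [JQ|_] := ifPn; last by exists set0; split; rewrite ?measure0//.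
  have F0 : 0 <= p * \prod_k F k (J k).
    rewrite mulr_ge0// prodr_ge0// => k _; rewrite /F; case: ifP => // _.
    by rewrite mulr_ge0 ?expR_ge0.
  have [gJ|_] := boolP (good J); last by exists set0; split; rewrite ?measure0.
  exists (A `&` [set w | forall k, k \in S -> [set y | c y = J k] (X k w)])%classic.
  split.
  - by apply: (measurable_box (B := fun k => [set y | c y = J k]%classic)).
  - rewrite (PAX (B := fun k => [set y | c y = J k]%classic))// lee_fin.
    rewrite ler_wpM2l// /F -big_mkcond/= big_split/= ler_peMr//.
      by apply: prodr_ge0 => k _; apply: q0.
    by rewrite -expR_sum -expR0 ler_expR -mulr_sumr mulr_ge0// ltW.
  - by move=> w Bw Aw _ _ cX; apply: Bw; split.
have := holds_off_and bounded_off (holds_off_forall cell_off).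
rewrite add0r -big_mkcond/= -mulr_sumr -bigA_distr_big_dep/=.
move=> /holds_offW; apply.
  rewrite ler_wpM2l//.
  apply: (@le_trans _ _ (\prod_(k in S) expR (2 * t * eps - t ^+ 2 / 2))).
    rewrite [leRHS]big_mkcond/=; apply: ler_prod => k _; rewrite /F /Q.
    have [kS|kS] := ifPn; last by rewrite /= big_pred1_eq ler01 lexx.
    rewrite sumr_ge0/=; last by move=> j _; rewrite mulr_ge0 ?expR_ge0.
    apply: hoeffding_step => //; first exact: sum_cells.
    exact: discretization_mean.
  by rewrite -expR_sum sumr_const ler_expR -mulr_natl; lra.
move=> w [X1 noJ] Aw; rewrite leNgt; apply/negP => dev.
pose J := [ffun k => if k \in S then c (X k w) else ord0].
apply: (noJ J Aw).
- by apply/familyP => k; rewrite ffunE inE /=; case: ifP; rewrite ?eqxx.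
- rewrite /good; apply: (@lt_le_trans _ _ (\sum_(k in S) (s * (X k w - mean) - t))).
    by rewrite sumrB sumr_const -[t *+ _]mulr_natl subr_gt0.
  apply: ler_sum => k kS; rewrite ffunE kS.
  have := xc _ (X1 k Aw kS); rewrite ler_norml; case: s1 => ->; lra.
- by move=> k kS; rewrite ffunE kS.
Qed.

Lemma hoeffding_off (t kappa : R) : 0 <= t -> 0 < kappa ->
  holds_off P (p * (2 * expR (kappa - #|S|%:R * (t ^+ 2 / 2))))
    (fun w => A w -> `|\sum_(k in S) (X k w - mean)| <= #|S|%:R * t).
Proof.
move=> t0 kappa0.
have off1 := hoeffding_one_sided (or_introl erefl) t0 kappa0.
have offN1 := hoeffding_one_sided (or_intror erefl) t0 kappa0.
apply: holds_offW (holds_off_and off1 offN1) _ _; first by lra.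
move=> w [ub lb] Aw; have := ub Aw; have := lb Aw.
by rewrite -!mulr_sumr ler_norml; lra.
Qed.

End hoeffding.

(** * Values, densities and the surrogate objective *)

Lemma sup_range_le (R : realType) (I : finType) (i0 : I) (g : I -> R) (c : R) :
  (forall i, g i <= c) -> sup [set x | exists i, x = g i]%classic <= c.
Proof.
move=> gc; apply: ge_sup; first by exists (g i0), i0.
by move=> _ [i ->].
Qed.

Lemma le_sup_range (R : realType) (I : finType) (g : I -> R) (i : I) :
  g i <= sup [set x | exists i, x = g i]%classic.
Proof.
apply: ub_le_sup; last by exists i.
exists (\sum_j `|g j|) => _ [j ->]; rewrite (bigD1 j)//= (le_trans (ler_norm _))//.
by rewrite lerDl sumr_ge0.
Qed.

Section values.
Context (R : realType) (m : nat) (Fac : finType) (A : 'I_m -> {set {set Fac}}).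
Implicit Types (pi : policy R m Fac) (p : {set Fac} -> R).
Implicit Types (r : 'I_m -> jact m Fac -> R) (rf : Fac -> nat -> R).

Lemma prodp_ge0 pi a : is_prod_policy A pi -> 0 <= prodp pi a.
Proof. by move=> Api; apply: prodr_ge0 => i _; case: (Api i). Qed.

Lemma sum_prodp pi : is_prod_policy A pi -> \sum_a prodp pi a = 1.
Proof.
move=> Api; rewrite /prodp -(bigA_distr_bigA (fun i s => pi i s)).
by rewrite big1// => i _; case: (Api i) => _ [].
Qed.

Lemma dev_prod_policy pi i p :
  is_prod_policy A pi -> is_policy (A i) p -> is_prod_policy A (dev pi i p).
Proof. by move=> Api Ap j; rewrite /dev; case: eqP => [->|_]; last exact: Api. Qed.

Lemma dev_id pi i : dev pi i (pi i) = pi.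
Proof. by apply/funext => j; rewrite /dev; case: eqP => [->|]. Qed.

Lemma le_value r r' i pi : is_prod_policy A pi ->
  (forall a, r i a <= r' i a) -> value r i pi <= value r' i pi.
Proof.
by move=> Api rr'; apply: ler_sum => a _; rewrite ler_wpM2l// prodp_ge0.
Qed.

Lemma valueD r r' i pi :
  value (fun i a => r i a + r' i a) i pi = value r i pi + value r' i pi.
Proof. by rewrite -big_split/=; apply: eq_bigr => a _; rewrite mulrDr. Qed.

Lemma valueN r i pi : value (fun i a => - r i a) i pi = - value r i pi.
Proof. by rewrite -sumrN; apply: eq_bigr => a _; rewrite mulrN. Qed.

(** A bound uniform in [pi]: it makes the sets of deviation values bounded, so that their [sup]
    dominates each member. *)
Lemma value_le_sum r i pi : is_prod_policy A pi ->
  value r i pi <= \sum_a `|r i a|.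
Proof.
move=> Api; apply: ler_sum => a _; apply: le_trans (ler_norm _) _.
rewrite normrM ger0_norm ?prodp_ge0// ler_piMl//.
rewrite -(sum_prodp Api) (bigD1 a)//= lerDl.
by apply: sumr_ge0 => b _; apply: prodp_ge0.
Qed.

(** By conversion, both [Vdag] and the inner supremum of [Gap] have this form. *)
Definition best_response r i pi : R :=
  sup [set y | exists p, is_policy (A i) p /\ y = value r i (dev pi i p)]%classic.

Lemma value_le_best r i pi p : is_prod_policy A pi -> is_policy (A i) p ->
  value r i (dev pi i p) <= best_response r i pi.
Proof.
move=> Api Ap; apply: ub_le_sup; last by exists p.
exists (\sum_a `|r i a|) => _ [p' [Ap' ->]].
by apply: value_le_sum; apply: dev_prod_policy.
Qed.

Lemma best_response_le r i pi c : is_prod_policy A pi ->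
  (forall p, is_policy (A i) p -> value r i (dev pi i p) <= c) ->
  best_response r i pi <= c.
Proof.
move=> Api pc; apply: ge_sup; last by move=> _ [p [Ap ->]]; apply: pc.
by exists (value r i (dev pi i (pi i))), (pi i).
Qed.

Lemma Nash_value_le rf pi i p : is_Nash A rf pi -> is_policy (A i) p ->
  value (reward rf) i (dev pi i p) <= value (reward rf) i pi.
Proof.
move=> [Api gap0] Ap.
have := le_sup_range
  (fun i => best_response (reward rf) i pi - value (reward rf) i pi) i.
rewrite -[X in _ <= X]/(Gap A rf pi) gap0 subr_le0; apply: le_trans.
exact: value_le_best.
Qed.

(** * Optimism and the surrogate objective *)

Section surrogate.
Variables (n : nat) (iota : R) (aseq : 'I_n -> jact m Fac) (rseq : 'I_n -> Fac -> R).
Variable rf : Fac -> nat -> R.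
Hypothesis m0 : (0 < m)%N.
Hypothesis rhat_close : forall i a,
  `|rhat aseq rseq i a - reward rf i a| <= bonus iota aseq i a.

(** Optimism: [rhat] plus the bonus dominates the mean reward in each best response, and [rhat]
    minus the bonus lies below it in each value of [pi]. *)
Lemma Gap_le_surrogate pi : is_prod_policy A pi ->
  Gap A rf pi <= surrogate A iota aseq rseq pi.
Proof.
move=> Api; apply: (sup_range_le (Ordinal m0)) => i.
apply: le_trans (le_sup_range (fun i =>
  Vdag A iota aseq rseq i pi - Vlo iota aseq rseq i pi) i).
apply: lerB; last first.
  by apply: le_value => // a; have := rhat_close i a; rewrite ler_norml; lra.
apply: best_response_le => // p Ap; apply: le_trans (value_le_best _ Api Ap).
apply: le_value; first exact: dev_prod_policy.
by move=> a; have := rhat_close i a; rewrite ler_norml; lra.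
Qed.

(** Optimistic and pessimistic rewards are each within two bonuses of the mean reward, and at
    equilibrium no deviation gains in mean reward. The value at equilibrium is the trivial
    deviation. *)
Lemma surrogate_Nash_le pistar g : is_Nash A rf pistar ->
  (forall i p, is_policy (A i) p ->
     value (bonus iota aseq) i (dev pistar i p) <= g) ->
  surrogate A iota aseq rseq pistar <= 4 * g.
Proof.
move=> Nash bg; have [Api _] := Nash.
apply: (sup_range_le (Ordinal m0)) => i.
have up : Vdag A iota aseq rseq i pistar <= value (reward rf) i pistar + 2 * g.
  apply: best_response_le => // p Ap.
  have Adev := dev_prod_policy Api Ap.
  apply: (@le_trans _ _ (value (fun i a => reward rf i a +
      (bonus iota aseq i a + bonus iota aseq i a)) i (dev pistar i p))).
    by apply: le_value => // a; have := rhat_close i a; rewrite ler_norml; lra.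
  rewrite !valueD; have := Nash_value_le Nash Ap; have := bg i p Ap; lra.
have lo : value (reward rf) i pistar - 2 * g <= Vlo iota aseq rseq i pistar.
  apply: (@le_trans _ _ (value (fun i a => reward rf i a +
      (- bonus iota aseq i a + - bonus iota aseq i a)) i pistar)).
    rewrite !valueD !valueN.
    by have := bg i _ (Api i); rewrite dev_id; lra.
  by apply: le_value => // a; have := rhat_close i a; rewrite ler_norml; lra.
lra.
Qed.

Lemma Gap_surrogate_min_le pistar g pi : is_Nash A rf pistar ->
  (forall i p, is_policy (A i) p ->
     value (bonus iota aseq) i (dev pistar i p) <= g) ->
  is_surrogate_min A iota aseq rseq pi -> Gap A rf pi <= 4 * g.
Proof.
move=> Nash bg [Api minpi]; apply: le_trans (Gap_le_surrogate Api) _.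
by apply: le_trans (minpi _ Nash.1) _; apply: surrogate_Nash_le.
Qed.

End surrogate.

(** * Facility densities and coverage *)

Lemma nf_le f (a : jact m Fac) : (nf f a <= m)%N.
Proof. by rewrite (leq_trans (max_card _))// card_ord. Qed.

Lemma sum_dens (w : Fac -> nat -> R) (q : jact m Fac -> R) f :
  \sum_a q a * w f (nf f a) = \sum_(l < m.+1) dens q f l * w f l.
Proof.
rewrite (partition_big (fun a => inord (nf f a) : 'I_m.+1) xpredT)//=.
apply: eq_bigr => l _; rewrite mulr_suml.
have nfE (a : jact m Fac) : (inord (nf f a) == l) = (nf f a == l).
  by rewrite -val_eqE/= inordK// ltnS nf_le.
by rewrite (eq_bigl _ _ nfE); apply: eq_bigr => a /eqP ->.
Qed.

Lemma sum_dens1 (q : jact m Fac -> R) f :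
  \sum_(l < m.+1) dens q f l = \sum_a q a.
Proof.
have := sum_dens (fun _ _ => 1) q f; under eq_bigr do rewrite mulr1.
by move=> ->; apply: eq_bigr => l _; rewrite mulr1.
Qed.

Lemma dens_ge0 (q : jact m Fac -> R) f l : (forall a, 0 <= q a) -> 0 <= dens q f l.
Proof. by move=> q0; apply: sumr_ge0. Qed.

(** As [w] is nonnegative, the sum over the facilities in [a i] may be extended to all of them;
    grouping actions by congestion level then gives the densities. *)
Lemma value_reward_le (w : Fac -> nat -> R) i pi : is_prod_policy A pi ->
  (forall f l, 0 <= w f l) ->
  value (reward w) i pi <= \sum_f \sum_(l < m.+1) dens (prodp pi) f l * w f l.
Proof.
move=> Api w0; under [leRHS]eq_bigr do rewrite -sum_dens.
rewrite exchange_big/=; apply: ler_sum => a _.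
rewrite -mulr_sumr ler_wpM2l ?prodp_ge0//.
by rewrite [leRHS](bigID [in a i])/= lerDl sumr_ge0.
Qed.

Section coverage.
Variables (pistar : policy R m Fac) (rho : jact m Fac -> R).
Hypothesis Api : is_prod_policy A pistar.
Hypothesis rho0 : forall a, 0 <= rho a.
Hypothesis cover : one_unit_deviation A pistar rho.

Local Notation C := (C_facility A pistar rho).

(** Where [rho] has density zero, coverage makes the deviation's density vanish too; elsewhere their
    ratio is in the set whose [sup] is [C]. *)
Lemma dens_le_C_facility i p f l : is_policy (A i) p -> (l <= m)%N ->
  dens (prodp (dev pistar i p)) f l <= C * dens rho f l.
Proof.
move=> Ap lm; have := dens_ge0 f l rho0; rewrite le_eqVlt => /predU1P[d0|d0].
  rewrite -d0 mulr0 leNgt; apply/negP => /(cover Ap lm).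
  by rewrite -d0 ltxx.
rewrite -ler_pdivrMr//; apply: ub_le_sup; last by exists i, p, f, l.
(* Densities of deviations are at most [1], so each ratio is at most one of these inverses; levels
   of density zero contribute [0^-1 = 0]. *)
exists (\sum_g \sum_(k < m.+1) (dens rho g k)^-1).
move=> _ [j [p' [g [k [Ap' km dgk ->]]]]].
have Adev := dev_prod_policy Api Ap'.
apply: (@le_trans _ _ (dens rho g k)^-1).
  rewrite ler_piMl ?invr_ge0 ?(ltW dgk)// -(sum_prodp Adev).
  rewrite -(sum_dens1 _ g) (bigD1 (Ordinal (km : (k < m.+1)%N)))//= lerDl.
  by apply: sumr_ge0 => h _; apply: dens_ge0 => a; apply: prodp_ge0.
rewrite (bigD1 g)//= (bigD1 (Ordinal (km : (k < m.+1)%N)))//= -addrA lerDl.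
by rewrite addr_ge0 ?sumr_ge0// => h _; rewrite ?sumr_ge0// => *;
  rewrite invr_ge0 dens_ge0.
Qed.

(** Summing the density bound over all levels of one facility compares two total masses equal to
    [1]. *)
Lemma C_facility_ge1 (i : 'I_m) (f : Fac) : \sum_a rho a = 1 -> 1 <= C.
Proof.
move=> rho1; rewrite -[C]mulr1 -[X in C * X]rho1 -(sum_dens1 _ f) mulr_sumr.
rewrite -[leLHS](sum_prodp Api) -(sum_dens1 _ f); apply: ler_sum => l _.
by rewrite -[pistar in leLHS](dev_id _ i) dens_le_C_facility// -ltnS.
Qed.

Variables (n : nat) (iota : R) (aseq : 'I_n -> jact m Fac).
Hypotheses (n0 : (0 < n)%N) (iota0 : 0 <= iota).
Hypothesis count_ge : forall f l, (l <= m)%N ->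
  n%:R * dens rho f l <= 4 * iota * (maxn (Ncount aseq f l) 1)%:R.

Lemma value_bonus_le i p : is_policy (A i) p -> 0 <= C ->
  value (bonus iota aseq) i (dev pistar i p) <=
    #|Fac|%:R * (2 * iota * Num.sqrt (C / n%:R) * Num.sqrt m.+1%:R).
Proof.
move=> Ap C0; have Adev := dev_prod_policy Api Ap.
(* With this weight, [bonus iota aseq] is [reward w] by conversion. *)
pose w f l := Num.sqrt (iota / (maxn (Ncount aseq f l) 1)%:R).
apply: le_trans (value_reward_le (w := w) i Adev (fun _ _ => sqrtr_ge0 _)) _.
rewrite mulr_natl -sumr_const; apply: ler_sum => f _.
set K := 2 * iota * _; set c := Num.sqrt _.
have K0 : 0 <= K by rewrite /K !mulr_ge0.
have c0 : 0 < c by rewrite sqrtr_gt0.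
have c2 : c ^+ 2 = m.+1%:R by rewrite sqr_sqrtr.
have n0' : 0 < n%:R :> R by rewrite ltr0n.
(* Termwise Cauchy-Schwarz. The new sum is [K * c]: the densities sum to [1], and [m.+1] copies of
   [K / (2 * c)] make [K * c / 2] as [c ^+ 2 = m.+1]. *)
apply: (@le_trans _ _ (\sum_(l < m.+1)
    (dens (prodp (dev pistar i p)) f l * (K * c / 2) + K / (2 * c)))).
  apply: ler_sum => l _; set x := dens _ _ _; set N := maxn (Ncount aseq f l) 1.
  have lm : (l <= m)%N by rewrite -ltnS.
  have x0 : 0 <= x by apply: dens_ge0 => a; apply: prodp_ge0.
  have N0 : 0 < N%:R :> R by rewrite ltr0n leq_max orbT.
  have xN : x / N%:R <= 4 * iota * C / n%:R.
    rewrite ler_pdivrMr// mulrAC ler_pdivlMr//.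
    apply: le_trans (ler_wpM2r (ltW n0') (dens_le_C_facility f Ap lm)) _.
    by have := ler_wpM2l C0 (count_ge f lm); rewrite -/N; lra.
  have -> : x * w f l = Num.sqrt (x * (iota * (x / N%:R))).
    rewrite -[x in LHS](ger0_norm x0) -sqrtr_sqr -sqrtrM ?sqr_ge0//.
    by congr Num.sqrt; rewrite /w -/N; ring.
  apply: (@le_trans _ _ (Num.sqrt x * K)).
    rewrite -[K](ger0_norm K0) -sqrtr_sqr -sqrtrM// ler_wsqrtr// ler_wpM2l//.
    apply: le_trans (ler_wpM2l iota0 xN) _.
    rewrite /K exprMn sqr_sqrtr ?divr_ge0 ?(ltW n0')//.
    by rewrite [leLHS](_ : _ = (2 * iota) ^+ 2 * (C / n%:R))//; ring.
  (* AM-GM on [sqrt x = sqrt (x c * 1/c)] *)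
  rewrite -subr_ge0 -{1}(sqr_sqrtr x0).
  have -> : Num.sqrt x ^+ 2 * (K * c / 2) + K / (2 * c) - Num.sqrt x * K =
      K / (2 * c) * (Num.sqrt x * c - 1) ^+ 2 by field; rewrite gt_eqF.
  by rewrite mulr_ge0 ?sqr_ge0// divr_ge0// mulr_ge0// ltW.
rewrite big_split/= -mulr_suml sum_dens1 sum_prodp// sumr_const card_ord.
rewrite -[_ *+ m.+1]mulr_natl -c2.
by rewrite [leLHS](_ : _ = K * c)//; field; rewrite gt_eqF.
Qed.

End coverage.
End values.

(** * Concentration of the offline data *)

Definition facility_mean (R : realType) m (Fac : finType) n
    (aseq : 'I_n -> jact m Fac) (rseq : 'I_n -> Fac -> R) f l : R :=
  (\sum_(k < n) rseq k f * (nf f (aseq k) == l)%:R)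
    / (maxn (Ncount aseq f l) 1)%:R.

(** Levels [l > 0] suffice because a facility used by player [i] has congestion at least [1]. *)
Lemma rhat_reward_le (R : realType) m (Fac : finType) n (iota : R)
    (aseq : 'I_n -> jact m Fac) rseq (rf : Fac -> nat -> R) :
  (forall f l, (0 < l <= m)%N -> `|facility_mean aseq rseq f l - rf f l| <=
     Num.sqrt (iota / (maxn (Ncount aseq f l) 1)%:R)) ->
  forall i a, `|rhat aseq rseq i a - reward rf i a| <= bonus iota aseq i a.
Proof.
move=> close i a; rewrite /rhat /reward -sumrB.
apply: le_trans (ler_norm_sum _ _ _) _; apply: ler_sum => f fa.
apply: close; rewrite nf_le andbT card_gt0; apply/set0Pn; exists i.
by rewrite inE.
Qed.

Section data.
Context (R : realType) (m : nat) (Fac : finType) (n : nat).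
Context (Rd : Fac -> nat -> probability R R) (rho : jact m Fac -> R).
Context d (Omega : measurableType d) (P : probability Omega R).
Context (aK : 'I_n -> Omega -> jact m Fac) (rK : 'I_n -> Fac -> Omega -> R).
Hypotheses (rho0 : forall a, 0 <= rho a) (rho1 : \sum_a rho a = 1).
Hypothesis Rd1 : forall f l, (1 <= l <= m)%N ->
  Rd f l `[(-1 : R), 1]%classic = 1%E.
Hypothesis maK : forall k a, measurable [set w | aK k w = a]%classic.
Hypothesis mrK : forall k f, measurable_fun setT (rK k f).
Hypothesis law : forall (as_ : 'I_n -> jact m Fac) (B : 'I_n -> Fac -> set R),
  (forall k f, measurable (B k f)) ->
  P [set w | (forall k, aK k w = as_ k) /\
             (forall k f, (0 < nf f (as_ k))%N -> B k f (rK k f w))]%classic =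
  (\prod_(k < n) (rho (as_ k) *
     \prod_(f | (0 < nf f (as_ k))%N) fine (Rd f (nf f (as_ k)) (B k f))))%:E.

Let action_event (as_ : 'I_n -> jact m Fac) : set Omega :=
  [set w | forall k, aK k w = as_ k]%classic.

Let measurable_action as_ : measurable (action_event as_).
Proof.
rewrite (_ : action_event _ =
    \bigcap_(k in [set: 'I_n]) [set w | aK k w = as_ k])%classic; last first.
  by apply/seteqP; split => w /= aw k => [_|]; apply: aw.
by apply: fin_bigcap_measurable; [exact: finite_finset|move=> k _; exact: maK].
Qed.

(** Supplies the box hypothesis of [hoeffding_off]. Other facilities and rounds get [setT], a factor
    [1]; [0 < l] makes [f] active in every round of [S]. *)
Lemma law_facility (as_ : 'I_n -> jact m Fac) f l (B : 'I_n -> set R) :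
  (0 < l)%N -> (forall k, measurable (B k)) ->
  let S := [set k | nf f (as_ k) == l] in
  P (action_event as_ `&` [set w | forall k, k \in S -> B k (rK k f w)])%classic =
    (\prod_k rho (as_ k) * \prod_(k in S) fine (Rd f l (B k)))%:E.
Proof.
move=> l0 mB S; pose B' k g := if (g == f) && (k \in S) then B k else setT.
have mB' k g : measurable (B' k g) by rewrite /B'; case: ifP.
transitivity (P [set w | (forall k, aK k w = as_ k) /\
    (forall k g, (0 < nf g (as_ k))%N -> B' k g (rK k g w))]%classic).
  congr (P _); apply/seteqP; split=> w [/= aw Bw]; split=> //=.
    by move=> k g _; rewrite /B'; case: ifP => // /andP[/eqP -> /Bw].
  move=> k kS; have := Bw k f; rewrite /B' eqxx kS; apply.
  by move: kS; rewrite inE => /eqP ->.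
rewrite law// big_split/=; congr (_ * _)%:E.
rewrite [RHS]big_mkcond/=; apply: eq_bigr => k _; case: ifPn => kS; last first.
  by rewrite big1// => g _; rewrite /B' (negbTE kS) andbF probability_setT.
have kl : nf f (as_ k) = l by move: kS; rewrite inE => /eqP.
rewrite (bigD1 f) ?kl//= big1 ?mulr1 => [|g /andP[_ /negbTE gf]].
  by rewrite /B' eqxx kS.
by rewrite /B' gf probability_setT.
Qed.

Lemma law_action as_ : P (action_event as_) = (\prod_k rho (as_ k))%:E.
Proof.
rewrite (_ : action_event as_ = [set w | (forall k, aK k w = as_ k) /\
    (forall k g, (0 < nf g (as_ k))%N -> setT (rK k g w))]%classic); last first.
  by apply/seteqP; split=> w //= [].
rewrite (@law as_ (fun _ _ => setT))//; congr EFin; apply: eq_bigr => k _.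
by rewrite big1 ?mulr1// => g _; rewrite probability_setT.
Qed.

Let prod_rho_ge0 (as_ : 'I_n -> jact m Fac) : 0 <= \prod_k rho (as_ k).
Proof. exact: prodr_ge0. Qed.

Let sum_prod_rho : \sum_(as_ : {ffun 'I_n -> jact m Fac}) \prod_k rho (as_ k) = 1.
Proof. by rewrite -(bigA_distr_bigA (fun _ a => rho a)) big1. Qed.

(* Chernoff bound from the moment [E exp (- N) <= exp (- n d / 2)]. *)
Lemma count_off f l (L : R) : 1 / 2 <= L ->
  holds_off P (expR (- L)) (fun w => n%:R * dens rho f l <=
    8 * L * (maxn (Ncount (aK ^~ w) f l) 1)%:R).
Proof.
move=> L2; have L0 : 0 < L by lra.
set x := n%:R * dens rho f l.
have [xL|Lx] := leP x (8 * L).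
  exists set0; split => // [|w _]; first by rewrite measure0 lee_fin expR_ge0.
  by rewrite (le_trans xL)// ler_peMr ?mulr_ge0 ?(ltW L0)// ler1n leq_max orbT.
pose rare as_ := 8 * L * (maxn (@Ncount m Fac n as_ f l) 1)%:R < x.
(* On a rare sequence the count is below [x / (8 * L)], so the exponential weight is at least
   [1]. *)
have rare_off (as_ : {ffun 'I_n -> jact m Fac}) :
    holds_off P (\prod_k rho (as_ k) * expR (x / (8 * L) - (Ncount as_ f l)%:R))
      (fun w => action_event as_ w -> ~ rare as_).
  have [ras|_] := boolP (rare as_); last first.
    by exists set0; split; rewrite ?measure0// lee_fin mulr_ge0 ?expR_ge0.
  exists (action_event as_); split; [exact: measurable_action| |by []].
  rewrite law_action lee_fin ler_peMr// -[leLHS]expR0 ler_expR subr_ge0.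
  rewrite ler_pdivlMr ?mulr_gt0// [leLHS]mulrC (le_trans _ (ltW ras))//.
  by rewrite ler_pM2l ?mulr_gt0// ler_nat leq_maxl.
apply: holds_offW (holds_off_forall rare_off) _ _; last first.
  move=> w noB; rewrite leNgt; apply/negP => ras.
  have aw : [ffun k => aK k w] = aK ^~ w :> ('I_n -> jact m Fac).
    by apply/funext => k; rewrite ffunE.
  by apply: (noB [ffun k => aK k w]); rewrite /action_event/= ?aw.
under eq_bigr => as_ _.
  rewrite expRD mulrCA /Ncount -sum1_card natr_sum -sumrN expR_sum.
  rewrite [X in _ * X](_ : _ = \prod_k (rho (as_ k) *
    expR (- (nf f (as_ k) == l)%:R))); last first.
    rewrite big_split/=; congr (_ * _); rewrite big_mkcond/=.
    by apply: eq_bigr => k _; rewrite inE; case: eqP; rewrite ?oppr0 ?expR0.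
  over.
rewrite -mulr_sumr -(bigA_distr_bigA (fun _ a => rho a *
  expR (- (nf f a == l)%:R))).
(* One round contributes at most [1 - dens rho f l / 2], since [expR (- 1) <= 1 / 2]. *)
have step : \sum_a rho a * expR (- (nf f a == l)%:R) <= expR (- (dens rho f l / 2)).
  apply: le_trans (expR_ge1Dx _); rewrite -[X in X + _]rho1.
  have -> : dens rho f l = \sum_a rho a * (nf f a == l)%:R.
    rewrite /dens big_mkcond/=; apply: eq_bigr => a _.
    by case: eqP; rewrite ?mulr1 ?mulr0.
  rewrite mulr_suml -sumrB; apply: ler_sum => a _.
  case: eqP => _; last by rewrite /= !mulr0n oppr0 expR0; lra.
  rewrite (_ : rho a - _ = rho a * 2^-1); last by rewrite /= mulr1n; field.
  rewrite /= !mulr1n ler_wpM2l// expRN lef_pV2 ?posrE ?expR_gt0//.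
  by have := expR_ge1Dx (1 : R); lra.
apply: (@le_trans _ _ (expR (x / (8 * L)) *
    \prod_(k < n) expR (- (dens rho f l / 2)))).
  rewrite ler_wpM2l ?expR_ge0//; apply: ler_prod => k _; rewrite step andbT.
  by apply: sumr_ge0 => a _; rewrite mulr_ge0 ?expR_ge0.
rewrite -expR_sum -expRD ler_expR sumr_const card_ord -[_ *+ n]mulr_natl.
have -> : n%:R * - (dens rho f l / 2) = - (x / 2) by rewrite /x; ring.
(* Expanding gives [x / 2 - x / (8 * L) >= 4 * L - 1], which is at least [L] by [L2]. *)
have : 0 <= (x - 8 * L) * (1 / 2 - (8 * L)^-1).
  rewrite mulr_ge0 ?subr_ge0 ?(ltW Lx)// -[leRHS]invrK lef_pV2 ?posrE; lra.
have -> : (x - 8 * L) * (1 / 2 - (8 * L)^-1) =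
    x / 2 - 4 * L + 1 - x / (8 * L) by field; rewrite gt_eqF.
lra.
Qed.

(** Hoeffding's inequality is applied given each sequence of joint actions; the probabilities of
    these sequences sum to [1]. *)
Lemma facility_mean_off f l (L : R) : (0 < l <= m)%N -> 1 / 2 <= L ->
  holds_off P (3 * expR (- L)) (fun w =>
    `|facility_mean (aK ^~ w) (fun k g => rK k g w) f l - mean_reward Rd f l| <=
    Num.sqrt (2 * L / (maxn (Ncount (aK ^~ w) f l) 1)%:R)).
Proof.
move=> /andP[l0 lm] L2.
have mu1 : Rd f l `[(-1 : R), 1]%classic = 1%E by apply: Rd1; rewrite l0.
have given (as_ : {ffun 'I_n -> jact m Fac}) :
    holds_off P (\prod_k rho (as_ k) * (3 * expR (- L))) (fun w =>
      action_event as_ w ->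
      `|facility_mean as_ (fun k g => rK k g w) f l - mean_reward Rd f l| <=
      Num.sqrt (2 * L / (maxn (Ncount as_ f l) 1)%:R)).
  pose S := [set k | nf f (as_ k) == l].
  have sumS w : \sum_(k < n) rK k f w * (nf f (as_ k) == l)%:R =
      \sum_(k in S) rK k f w.
    rewrite [RHS]big_mkcond/=; apply: eq_bigr => k _.
    by rewrite inE; case: eqP; rewrite ?mulr1 ?mulr0.
  rewrite /facility_mean /Ncount -/S.
  (* With no observation the estimate is [0], and the bonus [Num.sqrt (2 * L) >= 1] already covers
     the mean. *)
  have [S0|S0] := posnP #|S|.
    exists set0; split; first by [].
      by rewrite measure0 lee_fin mulr_ge0// mulr_ge0// expR_ge0.
    move=> w _ _; rewrite sumS S0 max0n divr1 divr1.
    rewrite (cards0_eq S0) big_set0 sub0r normrN.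
    apply: (@le_trans _ _ 1); first by rewrite ler_norml mean_bounds.
    by rewrite -[leLHS]sqrtr1 ler_wsqrtr//; lra.
  have N0 : 0 < #|S|%:R :> R by rewrite ltr0n.
  pose t := Num.sqrt (2 * L / #|S|%:R).
  have t2 : #|S|%:R * (t ^+ 2 / 2) = L.
    by rewrite sqr_sqrtr ?divr_ge0//; [field; rewrite gt_eqF|lra].
  have kappa0 : 0 < ln (3 / 2 : R) by rewrite ln_gt0//; lra.
  have := @hoeffding_off _ _ _ P _ S (action_event as_) (fun k => rK k f)
    (Rd f l) _ (measurable_action as_) (mrK ^~ f) mu1 (prod_rho_ge0 as_)
    (fun B => @law_facility as_ f l B l0) t _ (sqrtr_ge0 _) kappa0.
  move=> /holds_offW; apply.
    rewrite t2 ler_wpM2l// expRD lnK ?posrE; last by lra.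
    by rewrite mulrA; have := expR_ge0 (- L); lra.
  move=> w dev_le /dev_le; rewrite (maxn_idPl S0) -/t sumS.
  rewrite sumrB sumr_const -[_ *+ #|_|]mulr_natl [leRHS]mulrC -ler_pdivrMr//.
  move=> le_t.
  have -> : (\sum_(k in S) rK k f w) / #|S|%:R - mean_reward Rd f l =
      (\sum_(k in S) rK k f w - #|S|%:R * mean_reward Rd f l) / #|S|%:R.
    by field; rewrite gt_eqF.
  by rewrite normf_div (gtr0_norm N0).
apply: holds_offW (holds_off_forall given) _ _.
  by rewrite -mulr_suml sum_prod_rho mul1r.
move=> w /(_ [ffun k => aK k w]).
have -> : [ffun k => aK k w] = aK ^~ w :> ('I_n -> jact m Fac).
  by apply/funext => k; rewrite ffunE.
by apply.
Qed.

End data.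

(** * Union bound and final constants *)

Lemma half_le_ln (R : realType) (x : R) : 2 <= x -> 1 / 2 <= ln x.
Proof.
move=> x2; have x0 : 0 < x by lra.
have : expR (- ln x) <= 1 / 2; last by have := expR_ge1Dx (- ln x); lra.
by rewrite expRN lnK ?posrE// mul1r lef_pV2 ?posrE.
Qed.

Theorem theorem3
  (R : realType) (m : nat) (Fac : finType) (n : nat)
  (A : 'I_m -> {set {set Fac}})
  (Rd : Fac -> nat -> probability R R)
  (rho : jact m Fac -> R)
  (d : measure_display) (Omega : measurableType d) (P : probability Omega R)
  (aK : 'I_n -> Omega -> jact m Fac) (rK : 'I_n -> Fac -> Omega -> R)
  (pistar : policy R m Fac)
  (out : ('I_n -> jact m Fac) -> ('I_n -> Fac -> R) -> policy R m Fac)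
  (delta : R) :
  (0 < m)%N ->
  (0 < n)%N ->
  (forall i, A i != finset.set0) ->
  (* reward distributions supported in [-1,1] *)
  (forall f l, (1 <= l <= m)%N -> Rd f l `[(-1 : R), 1]%classic = 1%E) ->
  (* rho is a distribution on the joint action set A *)
  (forall a, 0 <= rho a) -> \sum_(a : jact m Fac) rho a = 1 ->
  (forall a, rho a != 0 -> forall i, a i \in A i) ->
  (* measurability of the data *)
  (forall k a, measurable [set w | aK k w = a]%classic) ->
  (forall k f, measurable_fun setT (rK k f)) ->
  (* law of the data: a^k i.i.d. ~ rho; given them, r^{f,k} ~ R^f(.|n^f(a^k))
     for every active facility, all draws independent *)
  (forall (as_ : 'I_n -> jact m Fac) (B : 'I_n -> Fac -> set R),
     (forall k f, measurable (B k f)) ->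
     P [set w | (forall k, aK k w = as_ k) /\
                (forall k f, (0 < nf f (as_ k))%N -> B k f (rK k f w))]%classic =
     (\prod_(k < n) (rho (as_ k) *
        \prod_(f | (0 < nf f (as_ k))%N) fine (Rd f (nf f (as_ k)) (B k f))))%:E) ->
  0 < delta < 1 ->
  is_Nash A (mean_reward Rd) pistar ->
  one_unit_deviation A pistar rho ->
  let iota := 2 * ln (4 * (m.+1)%:R * #|Fac|%:R / delta) in
  (forall aseq rseq, is_surrogate_min A iota aseq rseq (out aseq rseq)) ->
  exists E : set Omega, [/\ measurable E, ((1 - delta)%:E <= P E)%E &
    forall w, E w ->
      Gap A (mean_reward Rd) (out (fun k => aK k w) (fun k f => rK k f w))
      <= 8 * Num.sqrt (m.+1)%:R * C_facility A pistar rho * iota * #|Fac|%:R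
         / Num.sqrt n%:R].
Proof.
move=> m0 n0 _ Rd1 rho0 rho1 _ maK mrK law /andP[delta0 delta1].
move=> Nash cover iota outP.
set C := C_facility A pistar rho; have [Api _] := Nash.
pose L : R := ln (4 * m.+1%:R * #|Fac|%:R / delta).
have iotaE : iota = 2 * L by [].
have Fac_ge1 (f : Fac) : 1 <= #|Fac|%:R :> R.
  by rewrite ler1n; apply/card_gt0P; exists f.
have arg_ge2 (f : Fac) : 2 <= 4 * m.+1%:R * #|Fac|%:R / delta.
  have m1 : 1 <= m.+1%:R :> R by rewrite ler1n.
  have mF : 1 <= m.+1%:R * #|Fac|%:R :> R.
    by rewrite -[leLHS]mulr1 ler_pM ?Fac_ge1.
  (* [lra] fails to reify [Fac -> _ <= _] *)
  by rewrite ler_pdivlMr//; clear Fac_ge1; lra.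
have L2 (f : Fac) : 1 / 2 <= L by apply: half_le_ln; apply: arg_ge2.
(* With a facility, [C >= 1] lets [C] replace its square root. With none, [ln 0 = 0] and the [sup]
   of the empty set is [0]. *)
have [L0 C_le] : 0 <= L /\ (0 <= C /\ #|Fac|%:R * Num.sqrt C <= #|Fac|%:R * C).
  have [f _|noFac] := pickP (fun _ : Fac => true); last first.
    have Fac0 : #|Fac| = 0%N by apply: eq_card0 => f; have := noFac f.
    rewrite /L Fac0 !(mulr0, mul0r) ln0//; split=> //; split=> //.
    rewrite /C /C_facility (_ : [set x | _]%classic = set0) ?sup0//.
    by rewrite -subset0 => x [i [p [f]]]; have := noFac f.
  have C1 : 1 <= C by apply: (C_facility_ge1 Api _ _ (Ordinal m0) f).
  split; first by rewrite (le_trans _ (L2 f))// divr_ge0.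
  have C0 : 0 <= C by rewrite (le_trans ler01).
  split=> //; rewrite ler_wpM2l// -[leRHS](sqr_sqrtr C0) expr2 ler_peMl//.
  by rewrite -[leLHS]sqrtr1 ler_wsqrtr.
have [B [mB PB good]] : holds_off P delta (fun w => forall f (l : 'I_m.+1),
    (n%:R * dens rho f l <= 8 * L * (maxn (Ncount (aK ^~ w) f l) 1)%:R) /\
    ((0 < l)%N ->
     `|facility_mean (aK ^~ w) (fun k g => rK k g w) f l - mean_reward Rd f l| <=
     Num.sqrt (2 * L / (maxn (Ncount (aK ^~ w) f l) 1)%:R))).
  have e0 : 0 <= 3 * expR (- L) by rewrite mulr_ge0// expR_ge0.
  have mean_off f (l : 'I_m.+1) : holds_off P (3 * expR (- L)) (fun w => (0 < l)%N ->
     `|facility_mean (aK ^~ w) (fun k g => rK k g w) f l - mean_reward Rd f l| <=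
     Num.sqrt (2 * L / (maxn (Ncount (aK ^~ w) f l) 1)%:R)).
    have [l0|l0] := posnP l.
      by exists set0; split => [//||w _]; rewrite ?measure0// ltnn.
    have lm : (0 < l <= m)%N by rewrite l0 leq_ord.
    have /holds_offW := facility_mean_off rho0 rho1 Rd1 maK mrK law f lm (L2 f).
    by apply.
  (* Each of the [m.+1 * #|Fac|] pairs costs [4 * expR (- L)], in total exactly [delta] when there
     is a facility. *)
  apply: holds_offW (holds_off_forall (fun f => holds_off_forall (fun l : 'I_m.+1 =>
    holds_off_and (count_off rho0 rho1 maK law f l (L2 f)) (mean_off f l)))) _ _ => //.
  rewrite !sumr_const card_ord -!mulrnA -[_ *+ (_ * _)]mulr_natl natrM.
  have [f _|noFac] := pickP (fun _ : Fac => true); last first.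
    rewrite (_ : #|Fac| = 0%N) ?mulr0 ?mul0r ?ltW//.
    by apply: eq_card0 => f; have := noFac f.
  have x0 := lt_le_trans (ltr0Sn R 1) (arg_ge2 f).
  rewrite expRN lnK ?posrE// [leLHS](_ : _ = delta)//; field.
  by rewrite !gt_eqF ?ltr0n//= -(ltr0n R) (lt_le_trans ltr01) ?(Fac_ge1 f).
exists (~` B)%classic; split; first exact: measurableC.
  by rewrite probability_setC// EFinB leeB.
move=> w /good goodw.
have bonus_le i p : is_policy (A i) p ->
    value (bonus iota (aK ^~ w)) i (dev pistar i p) <=
    #|Fac|%:R * (2 * iota * Num.sqrt (C / n%:R) * Num.sqrt m.+1%:R).
  move=> Ap; apply: value_bonus_le => //; last by case: C_le.
    by rewrite iotaE mulr_ge0.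
  move=> f l lm; rewrite iotaE (_ : 4 * (2 * L) = 8 * L); last by ring.
  by have [] := goodw f (Ordinal (lm : (l < m.+1)%N)).
(* The factor [8] is [4] from the surrogate times [2] from the bonus bound. *)
apply: le_trans (Gap_surrogate_min_le m0 _ Nash bonus_le (outP _ _)) _.
  apply: rhat_reward_le => f l /andP[l0 lm].
  by have [_ /(_ l0)] := goodw f (Ordinal (lm : (l < m.+1)%N)).
have [C0 FC] := C_le.
rewrite sqrtrM// sqrtrV//.
rewrite [leLHS](_ : _ = 8 * Num.sqrt m.+1%:R * iota / Num.sqrt n%:R *
  (#|Fac|%:R * Num.sqrt C)); last by ring.
rewrite [leRHS](_ : _ = 8 * Num.sqrt m.+1%:R * iota / Num.sqrt n%:R *
  (#|Fac|%:R * C)); last by ring.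
by rewrite ler_wpM2l// iotaE !mulr_ge0 ?invr_ge0.
Qed.
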